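(* The projection $\pi_{\mathbb T}:\mathfrak D\to\mathbb T$, $\pi_{\mathbb T}([a_1+a_2i,b_1+b_2i,c_1+c_2i];(\alpha,\beta,\gamma))=(\alpha,\beta,\gamma)$, is the (real) blowup of the 2-torus $\mathbb T$ at the point $0=(0,0,0)$.
   Context: $\mathbb X=\{(a,b,c)\in\mathbb C^3:a+b+c=0\}$; $\mathbb P(\mathbb X)\subset\mathbb P^2(\mathbb C)$ is its projectivization, so $\mathbb P(\mathbb X)\cong\mathbb P^1(\mathbb C)$, regarded as a real surface. $\mathbb R/\pi$ means $\mathbb R/\pi\mathbb Z$, and $\mathbb T=\{(\alpha,\beta,\gamma)\in(\mathbb R/\pi)^3:\alpha+\beta+\gamma=0\}$, a 2-torus. A labeled, oriented, possibly-degenerate triangle is a tuple $(B_0;(a,b,c);[a_1,a_2,b_1,b_2,c_1,c_2];(\xi_a,\xi_b,\xi_c))\in\mathbb C\times\mathbb X\times\mathbb P^5(\mathbb R)\times(\mathbb R/\pi)^3$ such that: (i) if $(a,b,c)\ne(0,0,0)$ then $[a_1,a_2,b_1,b_2,c_1,c_2]=[\mathrm{Re}\,a,\mathrm{Im}\,a,\mathrm{Re}\,b,\mathrm{Im}\,b,\mathrm{Re}\,c,\mathrm{Im}\,c]$; (ii) if $(a,b,c)=(0,0,0)$ then $a_1+b_1+c_1=a_2+b_2+c_2=0$; (iii) if $a_1+a_2i\neq0$ then $\xi_a=\mathrm{Arg}(a_1+a_2i)\bmod\pi$, and similarly for $\xi_b,\xi_c$; (iv) if $a_1+a_2i=0$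 then $\xi_a\in\mathbb R/\pi$ is arbitrary, and similarly for $\xi_b,\xi_c$. Its interior angles are $(\alpha,\beta,\gamma)=(\xi_b-\xi_c,\xi_c-\xi_a,\xi_a-\xi_b)\in\mathbb T$, and its similarity class is $([a_1+a_2i,b_1+b_2i,c_1+c_2i];(\alpha,\beta,\gamma))\in\mathbb P(\mathbb X)\times\mathbb T$. $\mathfrak D\subset\mathbb P(\mathbb X)\times\mathbb T$ is the set of all such similarity classes. It is a smooth real surface, identified with the real blowup of $\mathbb P(\mathbb X)$ at the three points $[0,1,-1],[1,0,-1],[1,-1,0]$, the blowdown being the projection to $\mathbb P(\mathbb X)$. *)

(* Defs.v *)
(* The real numbers are an arbitrary [R : realType], the complex numbers [R[i]]. *)
From HB Require Import structures.
From mathcomp Require Import all_boot all_order all_algebra.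
From mathcomp Require Import generic_quotient.
From mathcomp Require Import all_classical all_reals all_analysis.
From mathcomp.real_closed Require Import complex.

Set Implicit Arguments.
Unset Strict Implicit.
Unset Printing Implicit Defensive.

Import Order.TTheory GRing.Theory Num.Theory.
Import numFieldNormedType.Exports.

Local Open Scope classical_set_scope.
Local Open Scope complex_scope.
Local Open Scope ring_scope.
Local Open Scope quotient_scope.

Fixpoint Ck (R : realType) (m n : nat) (k : nat) (W : set 'rV[R]_m)
    (g : 'rV[R]_m -> 'rV[R]_n) : Prop :=
  match k with
  | 0 => forall x, W x -> {for x, continuous g}
  | k'.+1 => (forall x, W x -> differentiable g x) /\
             (forall v : 'rV[R]_m, Ck k' W (fun x => 'D_v g x))
  end.

(* Meant for an open [W]. *)
Definition Cinfty (R : realType) (m n : nat) (W : set 'rV[R]_m)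
    (g : 'rV[R]_m -> 'rV[R]_n) : Prop :=
  forall k, Ck k W g.

(* A smooth manifold is presented by an atlas of local parametrizations (the
   inverses of charts) [par i : dom i -> pt].  The record carries no axioms:
   it is only used for R^n, (R/pi)^n, P^n(R), P^n(C) and their products, where
   the [dom i] are open, the [par i] are injective on [dom i] and jointly
   surjective, and the changes of coordinates are smooth. *)
Record atlas (R : realType) := Atlas {
  pt :> Type;
  mdim : nat;
  idx : Type;
  dom : idx -> set 'rV[R]_mdim;
  par : idx -> 'rV[R]_mdim -> pt }.

Arguments dom {R a} i.
Arguments par {R a} i u.

Definition mopen (R : realType) (M : atlas R) (O : set M) : Prop :=
  forall i : idx M, open (dom i `&` par i @^-1` O).

(* Smoothness of [f] on an arbitrary subset [A] of a manifold: around each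
   point of [A], read in charts, [f] is on [A] the restriction of a smooth map
   defined on an open set of the ambient coordinate space.  When [A] is an
   embedded submanifold this is smoothness for its submanifold structure. *)
Definition smooth_on (R : realType) (M N : atlas R) (A : set M) (f : M -> N)
    : Prop :=
  forall x, A x ->
    exists (i : idx M) (u : 'rV[R]_(mdim M)) (j : idx N)
           (W : set 'rV[R]_(mdim M)) (g : 'rV[R]_(mdim M) -> 'rV[R]_(mdim N)),
      [/\ par i u = x, W u, open W /\ W `<=` dom i, Cinfty W g &
          forall w, W w -> A (par i w) ->
            dom j (g w) /\ par j (g w) = f (par i w)].

Definition diffeo (R : realType) (M N : atlas R) (A : set M) (B : set N)
    (f : M -> N) : Prop :=
  exists g : N -> M,
    [/\ forall x, A x -> B (f x) /\ g (f x) = x,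
        forall y, B y -> A (g y) /\ f (g y) = y,
        smooth_on A f &
        smooth_on B g].

Definition prod_atlas (R : realType) (M N : atlas R) : atlas R :=
  @Atlas R (M * N)%type (mdim M + mdim N) (idx M * idx N)%type
    (fun ij => [set w | dom ij.1 (lsubmx w) /\ dom ij.2 (rsubmx w)])
    (fun ij w => (par ij.1 (lsubmx w), par ij.2 (rsubmx w))).

Definition euclid (R : realType) (n : nat) : atlas R :=
  @Atlas R 'rV[R]_n n unit (fun _ => setT) (fun _ u => u).

Section ProjectiveSpace.
Variables (K : fieldType) (n : nat).

(* Lines through the origin of K^(n+1). *)
Definition projspace := {l : {vspace 'rV[K]_n.+1} | (\dim l == 1)%N}.

Lemma dim_line0 : \dim <[const_mx 1 : 'rV[K]_n.+1]>%VS == 1%N.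
Proof.
rewrite dim_vline eqb1; apply/eqP => /matrixP /(_ 0 0) /eqP.
by rewrite !mxE oner_eq0.
Qed.

(* The point with homogeneous coordinates [v]; a junk value if [v = 0]. *)
Definition hpoint (v : 'rV[K]_n.+1) : projspace :=
  insubd (exist _ <[const_mx 1]>%VS dim_line0 : projspace) <[v]>%VS.

(* Some homogeneous coordinates of a point. *)
Definition hcoord (l : projspace) : 'rV[K]_n.+1 := vpick (val l).

(* The affine chart {x_i = 1}. *)
Definition affine (i : 'I_n.+1) (u : 'rV[K]_n) : projspace :=
  hpoint (\row_j if unlift i j is Some k then u 0 k else 1).

End ProjectiveSpace.

Definition RP (R : realType) (n : nat) : atlas R :=
  @Atlas R (projspace R n) n 'I_n.+1 (fun _ => setT) (fun i u => affine i u).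

Definition CP (R : realType) (n : nat) : atlas R :=
  @Atlas R (projspace R[i] n) (n + n) 'I_n.+1 (fun _ => setT)
    (fun i w => affine i (\row_k (lsubmx w 0 k +i* rsubmx w 0 k))).

Section Rpi.
Variable R : realType.

Definition eqmodpi (x y : R) : bool :=
  `[< exists k : int, x - y = k%:~R * pi >].

Lemma eqmodpi_refl : reflexive eqmodpi.
Proof. by move=> x; apply/asboolP; exists 0; rewrite subrr mul0r. Qed.

Lemma eqmodpi_sym : symmetric eqmodpi.
Proof.
suff H x y : eqmodpi x y -> eqmodpi y x by move=> x y; apply/idP/idP; apply: H.
by move=> /asboolP[k e]; apply/asboolP; exists (- k); rewrite -opprB e mulrNz mulNr.
Qed.

Lemma eqmodpi_trans : transitive eqmodpi.
Proof.
move=> y x z /asboolP[k e] /asboolP[l e']; apply/asboolP; exists (k + l).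
by rewrite mulrzDr mulrDl -e -e' addrA subrK.
Qed.

Canonical eqmodpi_equiv :=
  EquivRel eqmodpi eqmodpi_refl eqmodpi_sym eqmodpi_trans.

Definition Rpi := {eq_quot eqmodpi_equiv}.

HB.instance Definition _ := Choice.on Rpi.
HB.instance Definition _ : EqQuotient R eqmodpi_equiv Rpi := EqQuotient.on Rpi.

Definition modpi (x : R) : Rpi := \pi_Rpi x.

Lemma modpiP (x y : R) : reflect (exists k : int, x - y = k%:~R * pi)
                                 (modpi x == modpi y).
Proof. by rewrite /modpi eqmodE; exact: asboolP. Qed.

Definition Rpi_add (a b : Rpi) : Rpi := modpi (repr a + repr b).
Definition Rpi_opp (a : Rpi) : Rpi := modpi (- repr a).

Lemma modpi_repr (a : Rpi) : modpi (repr a) = a.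
Proof. exact: reprK. Qed.

Lemma repr_modpi (x : R) : exists k : int, repr (modpi x) - x = k%:~R * pi.
Proof. by apply/modpiP; rewrite modpi_repr. Qed.

Lemma modpi_add x y : Rpi_add (modpi x) (modpi y) = modpi (x + y).
Proof.
have [k ek] := repr_modpi x; have [l el] := repr_modpi y.
apply/eqP/modpiP; exists (k + l).
by rewrite mulrzDr mulrDl -ek -el opprD addrACA.
Qed.

Lemma modpi_opp x : Rpi_opp (modpi x) = modpi (- x).
Proof.
have [k ek] := repr_modpi x; apply/eqP/modpiP; exists (- k).
by rewrite mulrNz mulNr -ek opprD.
Qed.

Lemma Rpi_addA : associative Rpi_add.
Proof.
move=> a b c; rewrite -(modpi_repr a) -(modpi_repr b) -(modpi_repr c).
by rewrite !modpi_add addrA.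
Qed.

Lemma Rpi_addC : commutative Rpi_add.
Proof. by move=> a b; rewrite /Rpi_add addrC. Qed.

Lemma Rpi_add0 : left_id (modpi 0) Rpi_add.
Proof. by move=> a; rewrite -(modpi_repr a) modpi_add add0r. Qed.

Lemma Rpi_addN : left_inverse (modpi 0) Rpi_opp Rpi_add.
Proof. by move=> a; rewrite -(modpi_repr a) modpi_opp modpi_add addNr. Qed.

HB.instance Definition _ :=
  GRing.isZmodule.Build Rpi Rpi_addA Rpi_addC Rpi_add0 Rpi_addN.

Lemma modpi0 : modpi 0 = 0. Proof. by []. Qed.

Lemma modpiD : {morph modpi : x y / x + y}.
Proof. by move=> x y; rewrite -modpi_add. Qed.

Lemma modpiN : {morph modpi : x / - x}.
Proof. by move=> x; rewrite -modpi_opp. Qed.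

(* (R/pi)^n, parametrized by the restrictions of R^n -> (R/pi)^n to the open
   cubes of side pi. *)
Definition Rpi_power (n : nat) : atlas R :=
  @Atlas R 'rV[Rpi]_n n 'rV[R]_n
    (fun c => [set u : 'rV[R]_n | forall j, `|u 0 j - c 0 j| < pi / 2])
    (fun _ u => \row_j modpi (u 0 j)).

End Rpi.

Definition plane_x_RP1 (R : realType) : atlas R :=
  prod_atlas (euclid R 2) (RP R 1).

(* The blowup at the origin of a subset [V] of R^2, the blowdown being the
   first projection. *)
Definition plane_blowup (R : realType) (V : set 'rV[R]_2)
    : set (plane_x_RP1 R) :=
  [set z : 'rV[R]_2 * projspace R 1 | V z.1 /\ z.1 \in val z.2].

(* [f : S -> T] is the real blowup of the surface [T] at [p] when it is a
   smooth map, a diffeomorphism over [T \ p], and, in a chart [phi] of [T]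
   centered at [p], it is isomorphic over [T] to the standard blowup of the
   plane at the origin.  [S] and [T] are embedded in ambient manifolds. *)
Definition is_real_blowup (R : realType) (N M : atlas R) (S : set N)
    (T : set M) (p : M) (f : N -> M) : Prop :=
  [/\ T p,
      smooth_on S f,
      diffeo (S `\` f @^-1` [set p]) (T `\ p) f &
      exists (V : set 'rV[R]_2) (O : set M) (phi : euclid R 2 -> M)
             (Phi : plane_x_RP1 R -> N),
        [/\ open V /\ V 0, mopen O,
            diffeo (V : set (euclid R 2)) (T `&` O) phi /\ phi 0 = p,
            diffeo (plane_blowup V) (S `&` f @^-1` O) Phi &
            forall z, plane_blowup V z -> f (Phi z) = phi z.1]].

Section Triangles.
Variable R : realType.
Local Notation C := R[i].
Local Notation Re := (@complex.Re R).
Local Notation Im := (@complex.Im R).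

Definition row3 (K : Type) (x y z : K) : 'rV[K]_3 :=
  \row_(j < 3) nth x [:: x; y; z] j.

Definition row6 (K : Type) (x y z t u v : K) : 'rV[K]_6 :=
  \row_(j < 6) nth x [:: x; y; z; t; u; v] j.

Definition XX : set (C * C * C) := [set s | s.1.1 + s.1.2 + s.2 = 0].

Definition TT : set (Rpi_power R 3) := [set t : 'rV[Rpi R]_3 | t 0 0 + t 0 1 + t 0 2 = 0].

(* [xi] is Arg z mod pi. *)
Definition arg_modpi (z : C) (xi : Rpi R) : Prop :=
  exists r theta : R,
    [/\ 0 < r, z = (r * cos theta) +i* (r * sin theta) & xi = modpi theta].

Record triangle_data := TriangleData {
  B0 : C;
  sides : C * C * C;
  directions : projspace R 5;
  slopes : Rpi R * Rpi R * Rpi R }.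

(* The numbers a_1 + a_2 i, b_1 + b_2 i, c_1 + c_2 i for homogeneous coordinates
   [a_1, a_2, b_1, b_2, c_1, c_2] of [x].  They are determined up to a common
   nonzero real factor, and every use below is invariant under such a factor. *)
Definition dir_a (x : projspace R 5) : C :=
  let h := hcoord x in h 0 (inord 0) +i* h 0 (inord 1).
Definition dir_b (x : projspace R 5) : C :=
  let h := hcoord x in h 0 (inord 2) +i* h 0 (inord 3).
Definition dir_c (x : projspace R 5) : C :=
  let h := hcoord x in h 0 (inord 4) +i* h 0 (inord 5).

Definition triangle (tau : triangle_data) : Prop :=
  let: (a, b, c) := sides tau in
  let: (xi_a, xi_b, xi_c) := slopes tau in
  let x := directions tau in
  [/\ XX (a, b, c),
      (a, b, c) <> (0, 0, 0) ->
        x = hpoint (row6 (Re a) (Im a) (Re b) (Im b) (Re c) (Im c)),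
      (a, b, c) = (0, 0, 0) ->
        Re (dir_a x) + Re (dir_b x) + Re (dir_c x) = 0 /\
        Im (dir_a x) + Im (dir_b x) + Im (dir_c x) = 0 &
      [/\ dir_a x <> 0 -> arg_modpi (dir_a x) xi_a,
          dir_b x <> 0 -> arg_modpi (dir_b x) xi_b &
          dir_c x <> 0 -> arg_modpi (dir_c x) xi_c]].

Definition angles (tau : triangle_data) : Rpi_power R 3 :=
  let: (xi_a, xi_b, xi_c) := slopes tau in
  row3 (xi_b - xi_c) (xi_c - xi_a) (xi_a - xi_b).

Definition similarity_class (tau : triangle_data)
    : prod_atlas (CP R 2) (Rpi_power R 3) :=
  let x := directions tau in
  (hpoint (row3 (dir_a x) (dir_b x) (dir_c x)), angles tau).

(* The surface of similarity classes, as a subset of P^2(C) x (R/pi)^3 (it is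
   contained in P(X) x T), whence its smooth structure. *)
Definition DD : set (prod_atlas (CP R 2) (Rpi_power R 3)) :=
  [set similarity_class tau | tau in triangle].

Definition pi_TT (s : prod_atlas (CP R 2) (Rpi_power R 3)) : Rpi_power R 3 :=
  s.2.

End Triangles.

Arguments TT : clear implicits.
Arguments DD : clear implicits.
Arguments pi_TT : clear implicits.

(* Main.v *)
(* A similarity class with angles alpha, beta is the point
   [p e^(-i beta) : q e^(i alpha) : r] of P^2(C), where p, q, r are the signed
   side lengths.  The triangle closes up exactly when p sin beta = q sin alpha
   and r = - (p cos beta + q cos alpha), so the class is determined by its
   angles and [p : q] in P^1(R).  If the angles are not all zero then
   [p : q] = [sin alpha : sin beta] (law of sines); near zero, in the
   coordinates x = tan alpha, y = tan beta on the torus and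
   [p cos beta : q cos alpha] on P^1(R), the closing condition says that (x, y)
   lies on that line, which is the equation of the blowup of the plane. *)
Require Import Defs.
From mathcomp Require Import all_boot all_order all_algebra.
From mathcomp Require Import all_classical all_reals all_analysis.
From mathcomp Require Import ring.
From mathcomp.real_closed Require Import complex.

Set Implicit Arguments.
Unset Strict Implicit.
Unset Printing Implicit Defensive.

Import Order.TTheory GRing.Theory Num.Theory.
Import numFieldNormedType.Exports.

Local Open Scope classical_set_scope.
Local Open Scope complex_scope.
Local Open Scope ring_scope.

(** Smoothness on a subset asks, near each point, for a smooth extension to an open set of chart
    coordinates, so every map and every inverse needs a local formula that still makes sense off the
    surface. All formulas here come from coordinates by field operations, sine, cosine and
    arctangent, a class stable under differentiation.

    The obstacle is choice: homogeneous coordinates are known up to a factor and angles up to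
    multiples of pi. Adding pi to alpha forces q to change sign, so [p : q] depends on the lifts,
    whereas p cos beta and q cos alpha do not: they are the projections of the first two sides on
    the line of the third, which explains the coordinate on P^1(R). To invert the blowup chart, this
    real pair must be read off a point of P^2(C), which gives it only up to an unknown complex
    factor; pairing with a fixed real reference vector and multiplying by the conjugate of the
    result makes that factor real. *)

Lemma near_eq_differentiable (R : realFieldType) (V W : normedModType R)
    (f g : V -> W) (x : V) :
  (\near x, f x = g x) -> differentiable f x -> differentiable g x.
Proof.
move=> fg df; apply/diffP => /=.
(* ['d g x] is a chosen linear map with the little-o property, so it suffices to exhibit one.
   ['d f x] qualifies because the estimate only sees values near [x]. *)
apply: (@getPex _ (fun (df : {linear V -> W}) => continuous df /\
  forall y, g y = g (lim (nbhs x)) + df (y - lim (nbhs x))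
                  +o_(y \near x) (y - lim (nbhs x)))).
exists ('d f x); split; first exact: diff_continuous.
have gE : g = (fun y => g (lim (nbhs x)) + 'd f x (y - lim (nbhs x)))
    +o_x (center (lim (nbhs x))).
  apply/eqaddoP => e e0; have [[_ /eqaddoP /(_ e e0)]] := df.
  have fgx := nbhs_singleton fg.
  rewrite !lim_id//; apply: filterS2 fg => y fgy.
  by rewrite /= !fctE /= fgy fgx.
by move=> y; rewrite {1}gE.
Qed.

(** * A class of real functions closed under differentiation *)

Section ElementarySmoothFunctions.
Context {R : realType} {m : nat}.
Implicit Types (W : set 'rV[R]_m) (f g : 'rV[R]_m -> R).

(* This class contains the derivatives of its members, so membership gives
   smoothness of all orders at once. *)
Inductive elementary W : ('rV[R]_m -> R) -> Prop :=
| elementary_ext f g : (forall x, W x -> f x = g x) ->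
    elementary W f -> elementary W g
| elementary_cst c : elementary W (fun=> c)
| elementary_coord j : elementary W (fun x => x 0 j)
| elementaryD f g : elementary W f -> elementary W g ->
    elementary W (fun x => f x + g x)
| elementaryM f g : elementary W f -> elementary W g ->
    elementary W (fun x => f x * g x)
| elementaryV f : (forall x, W x -> f x != 0) -> elementary W f ->
    elementary W (fun x => (f x)^-1)
| elementary_sin f : elementary W f -> elementary W (fun x => sin (f x))
| elementary_cos f : elementary W f -> elementary W (fun x => cos (f x))
| elementary_atan f : elementary W f -> elementary W (fun x => atan (f x)).

Lemma elementaryN W f : elementary W f -> elementary W (fun x => - f x).
Proof.
move=> sf; apply: elementary_ext (elementaryM (elementary_cst W (-1)) sf).
by move=> x _; rewrite mulN1r.
Qed.

Lemma elementaryB W f g : elementary W f -> elementary W g ->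
  elementary W (fun x => f x - g x).
Proof. by move=> sf sg; apply: elementaryD => //; exact: elementaryN. Qed.

Lemma elementaryS W W' f : W' `<=` W -> elementary W f -> elementary W' f.
Proof.
move=> WW'; elim=> {f}; try by move=> *; constructor; auto.
by move=> f g fg _; apply: elementary_ext => x /WW'; exact: fg.
Qed.

Lemma is_derive_comp_scalar f (h : R -> R) (x v : 'rV[R]_m) (dh : R) :
  differentiable f x -> is_derive (f x) 1 h dh ->
  differentiable (fun y => h (f y)) x /\
  'D_v (fun y => h (f y)) x = dh * 'D_v f x.
Proof.
move=> df [dhx hE]; have dh' : differentiable h (f x) by apply/derivable1_diffP.
have dc : differentiable (h \o f) x by exact: differentiable_comp.
split => //; rewrite -[LHS]/('D_v (h \o f) x) deriveE// diff_comp//= deriveE//.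
by rewrite (deriv1E dhx) derive1E hE; rewrite /GRing.scale /= mulrC.
Qed.

(** Induction on membership. For [elementary_ext], openness of [W] turns agreement on [W] into
    agreement near each of its points, which is all that a derivative sees. For the inverse, sine,
    cosine and arctangent, the outer derivative in the chain rule is again made from the
    constructors. *)
Lemma elementary_derive W f : open W -> elementary W f ->
  (forall x, W x -> differentiable f x) /\
  (forall v, elementary W ('D_v f)).
Proof.
move=> oW; have nW x : W x -> \near x, W x by move=> Wx; exact: open_nbhs_nbhs.
elim=> {f}.
- move=> f g fg _ [df sf]; have nfg x : W x -> \near x, f x = g x.
    by move=> /nW; apply: filterS => y; exact: fg.
  split=> [x Wx|v]; first exact: near_eq_differentiable (nfg x Wx) (df x Wx).
  by apply: elementary_ext (sf v) => x Wx; exact/near_eq_derive/nfg.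
- move=> c; split=> [x _|v]; first exact: differentiable_cst.
  by apply: elementary_ext (elementary_cst W 0) => x _; rewrite derive_cst.
- move=> j; split=> [x _|v]; first exact: differentiable_coord.
  apply: elementary_ext (elementary_cst W (v 0 j)) => x _.
  have := @derive_id _ 'rV[R]_m x v; rewrite derive_mx// => /rowP /(_ j).
  by rewrite mxE.
- move=> f g _ [df sf] _ [dg sg]; split=> [x Wx|v].
    by apply: differentiableD; auto.
  apply: elementary_ext (elementaryD (sf v) (sg v)) => x Wx.
  by rewrite -deriveD//; apply: diff_derivable; auto.
- move=> f g ef [df sf] eg [dg sg]; split=> [x Wx|v].
    by apply: differentiableM; auto.
  apply: elementary_ext
    (elementaryD (elementaryM ef (sg v)) (elementaryM eg (sf v))) => x Wx.
  by rewrite -[RHS]/('D_v (f * g) x) deriveM//; apply: diff_derivable; auto.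
- move=> f f0 ef [df sf].
  have H x v : W x -> differentiable (fun y => (f y)^-1) x /\
     'D_v (fun y => (f y)^-1) x = - ((f x)^-1 * (f x)^-1) * 'D_v f x.
    move=> Wx; apply: (@is_derive_comp_scalar f (fun y => y^-1)); first exact: df.
    have := @is_deriveV R id (f x) 1 1 (f0 x Wx) (is_derive_id _ _).
    move=> /is_derive_eq; apply.
    by rewrite expr2 invfM /GRing.scale /= mulr1.
  split=> [x Wx|v]; first by case: (H x 0 Wx).
  apply: elementary_ext (elementaryM (elementaryN (elementaryM
    (elementaryV f0 ef) (elementaryV f0 ef))) (sf v)) => x Wx.
  by case: (H x v Wx).
- move=> f ef [df sf].
  have H x v : W x -> differentiable (fun y => sin (f y)) x /\
     'D_v (fun y => sin (f y)) x = cos (f x) * 'D_v f x.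
    by move=> Wx; apply: is_derive_comp_scalar; first exact: df.
  split=> [x Wx|v]; first by case: (H x 0 Wx).
  apply: elementary_ext (elementaryM (elementary_cos ef) (sf v)) => x Wx.
  by case: (H x v Wx).
- move=> f ef [df sf].
  have H x v : W x -> differentiable (fun y => cos (f y)) x /\
     'D_v (fun y => cos (f y)) x = - sin (f x) * 'D_v f x.
    by move=> Wx; apply: is_derive_comp_scalar; first exact: df.
  split=> [x Wx|v]; first by case: (H x 0 Wx).
  apply: elementary_ext (elementaryM (elementaryN (elementary_sin ef)) (sf v)).
  by move=> x Wx; case: (H x v Wx).
- move=> f ef [df sf].
  have H x v : W x -> differentiable (fun y => atan (f y)) x /\
     'D_v (fun y => atan (f y)) x = (1 + f x * f x)^-1 * 'D_v f x.
    move=> Wx; have ha := is_derive1_atan (f x).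
    by have := is_derive_comp_scalar v (df _ Wx) ha; rewrite expr2.
  split=> [x Wx|v]; first by case: (H x 0 Wx).
  have p x : W x -> 1 + f x * f x != 0.
    by move=> _; rewrite lt0r_neq0// ltr_pwDl// -expr2 sqr_ge0.
  apply: elementary_ext (elementaryM (elementaryV p
    (elementaryD (elementary_cst W 1) (elementaryM ef ef))) (sf v)) => x Wx.
  by case: (H x v Wx).
Qed.

(** The induction on the order generalizes over [g], since its step passes to ['D_v g], whose
    coordinates are again elementary. *)
Lemma elementary_Cinfty n W (g : 'rV[R]_m -> 'rV[R]_n) : open W ->
  (forall j, elementary W (fun x => g x 0 j)) -> Cinfty W g.
Proof.
move=> oW sg k.
have dg (h : 'rV[R]_m -> 'rV[R]_n) x : W x ->
  (forall j, elementary W (fun x => h x 0 j)) -> differentiable h x.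
  move=> Wx sh.
  rewrite (_ : h = \sum_(j < n) (fun y => h y 0 j *: delta_mx 0 j)); last first.
    by apply/funext => y; rewrite fct_sumE [LHS]row_sum_delta.
  apply: differentiable_sum => j; apply: differentiableZl.
  exact: (elementary_derive oW (sh j)).1.
elim: k g sg => [|k IH] g sg /=.
  by move=> x Wx; apply: differentiable_continuous; exact: dg.
split=> [x Wx|v]; first exact: dg.
apply: IH => j; apply: elementary_ext ((elementary_derive oW (sg j)).2 v) => x Wx.
by rewrite derive_mx ?mxE//; apply: diff_derivable; exact: dg.
Qed.

Lemma elementary_open_neq0 W f : open W -> elementary W f ->
  open (W `&` [set x | f x != 0]).
Proof.
move=> oW ef; rewrite openE => x [Wx fx]; apply: filterI.
  exact: open_nbhs_nbhs.
have cf := differentiable_continuous ((elementary_derive oW ef).1 x Wx).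
have nf : nbhs (f x) [set y | y != 0].
  by apply: open_nbhs_nbhs; split => //; exact: open_neq.
exact: (cf _ nf).
Qed.

Lemma elementary_open_box n W (g : 'I_n -> 'rV[R]_m -> R) (c : 'I_n -> R) e :
  open W -> (forall j, elementary W (g j)) ->
  open (W `&` [set x | forall j, `|g j x - c j| < e]).
Proof.
move=> oW eg; rewrite openE => x [Wx gx]; apply: filterI.
  exact: open_nbhs_nbhs.
suff : \forall y \near x, forall j, `|g j y - c j| < e by [].
apply: (@filter_forall _ _ (fun j y => `|g j y - c j| < e) _ (nbhs_filter x)) => j.
have cg := differentiable_continuous ((elementary_derive oW (eg j)).1 x Wx).
have ng : nbhs (g j x) [set r | `|r - c j| < e].
  have d0 : 0 < e - `|g j x - c j| by rewrite subr_gt0.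
  apply: filterS (nbhsx_ballx (g j x) _ d0) => r /=.
  rewrite -ball_normE /= distrC => rd; rewrite -(subrKA (g j x)).
  by rewrite (le_lt_trans (ler_normD _ _))// -ltrBrDr.
exact: (cg _ ng).
Qed.

End ElementarySmoothFunctions.

(** * Homogeneous coordinates and affine charts of projective space *)

Section HomogeneousCoordinates.
Variables (K : fieldType) (n : nat).
Implicit Types (v w : 'rV[K]_n.+1) (l : projspace K n).

Lemma val_hpoint v : v != 0 -> val (hpoint v) = <[v]>%VS.
Proof. by move=> v0; rewrite /hpoint val_insubd dim_vline v0 eqxx. Qed.

Lemma hpointZ (k : K) v : k != 0 -> hpoint (k *: v) = hpoint v.
Proof.
move=> k0; rewrite /hpoint; congr insubd; apply/eqP; rewrite eqEsubv.
apply/andP; split; rewrite -memvE.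
  by rewrite memvZ// memv_line.
by rewrite -[X in X \in _](scalerK k0) memvZ// memv_line.
Qed.

Lemma hpoint_eqP v w : v != 0 -> w != 0 -> hpoint v = hpoint w ->
  exists2 k, k != 0 & v = k *: w.
Proof.
move=> v0 w0 /(congr1 val); rewrite !val_hpoint// => vw.
have /vlineP[k vk] : v \in <[w]>%VS by rewrite -vw memv_line.
by exists k => //; apply: contraNneq v0 => k0; rewrite vk k0 scale0r.
Qed.

Lemma hcoord_neq0 l : hcoord l != 0.
Proof. by rewrite vpick0 -dimv_eq0 (eqP (valP l)). Qed.

Lemma hcoordK l : hpoint (hcoord l) = l.
Proof.
apply: val_inj; rewrite val_hpoint ?hcoord_neq0//; apply/eqP.
rewrite eqEdim -memvE memv_pick dim_vline hcoord_neq0.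
by rewrite (eqP (valP l)).
Qed.

(** The vector under [hpoint] in [affine], named so that points of a chart can be handled like any
    other homogeneous coordinates. *)
Definition affine_coord (i : 'I_n.+1) (u : 'rV[K]_n) : 'rV[K]_n.+1 :=
  \row_j if unlift i j is Some k then u 0 k else 1.

Lemma affine_coord_neq0 i u : affine_coord i u != 0.
Proof.
apply/eqP => /rowP /(_ i) /eqP; rewrite !mxE.
by case: unliftP => [j /eqP|_]; rewrite ?(negbTE (neq_lift _ _)) ?oner_eq0.
Qed.

Lemma hpoint_affine i v : v 0 i != 0 ->
  hpoint v = affine i (\row_k (v 0 (lift i k) / v 0 i)).
Proof.
move=> vi; rewrite /affine -[LHS](@hpointZ (v 0 i)^-1) ?invr_neq0//.
congr hpoint; apply/rowP => j; rewrite !mxE.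
case: unliftP => [k ->|->]; first by rewrite mxE mulrC.
by rewrite mulVf.
Qed.

Lemma row_neq0 v : v != 0 -> exists i, v 0 i != 0.
Proof.
move=> v0; apply/existsP; apply: contraNT v0; rewrite negb_exists.
move=> /forallP h; apply/eqP/rowP => j; rewrite mxE.
by apply/eqP; move: (h j); rewrite negbK.
Qed.

Lemma affine_surj l : exists i u, affine i u = l.
Proof.
have [i li] := row_neq0 (hcoord_neq0 l).
by rewrite -{1}(hcoordK l) (hpoint_affine li); exists i; eexists.
Qed.

End HomogeneousCoordinates.

(** * Local chart expressions of maps into products, tori and projective spaces *)

Section SmoothRepresentations.
Context {R : realType} {m : nat}.
Implicit Types (W : set 'rV[R]_m) (u w : 'rV[R]_m).

Definition elementary_row n W (g : 'rV[R]_m -> 'rV[R]_n) :=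
  forall j, elementary W (fun x => g x 0 j).

Definition elementaryC W (f : 'rV[R]_m -> R[i]) :=
  elementary W (fun x => complex.Re (f x)) /\
  elementary W (fun x => complex.Im (f x)).

Lemma elementaryCD W f g : elementaryC W f -> elementaryC W g ->
  elementaryC W (fun x => f x + g x).
Proof.
move=> [f1 f2] [g1 g2]; split.
  by apply: elementary_ext (elementaryD f1 g1) => x _; case: (f x) (g x) => ? ? [].
by apply: elementary_ext (elementaryD f2 g2) => x _; case: (f x) (g x) => ? ? [].
Qed.

Lemma elementaryCM W f g : elementaryC W f -> elementaryC W g ->
  elementaryC W (fun x => f x * g x).
Proof.
move=> [f1 f2] [g1 g2]; split.
  apply: elementary_ext (elementaryB (elementaryM f1 g1) (elementaryM f2 g2)).
  by move=> x _; case: (f x) (g x) => ? ? [].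
apply: elementary_ext (elementaryD (elementaryM f1 g2) (elementaryM f2 g1)).
by move=> x _; case: (f x) (g x) => ? ? [].
Qed.

Lemma elementaryC_conj W f : elementaryC W f ->
  elementaryC W (fun x => (f x)^*).
Proof.
move=> [f1 f2]; split.
  by apply: elementary_ext f1 => x _; case: (f x).
by apply: elementary_ext (elementaryN f2) => x _; case: (f x).
Qed.

Lemma elementaryC_cst W c : elementaryC W (fun=> c).
Proof. by split; exact: elementary_cst. Qed.

Lemma sqr_Re_Im_eq0 (z : R[i]) :
  (complex.Re z * complex.Re z + complex.Im z * complex.Im z == 0) = (z == 0).
Proof.
by case: z => a b; rewrite -!expr2 paddr_eq0 ?sqr_ge0// !sqrf_eq0 eq_complex.
Qed.

Lemma elementaryCV W f : (forall x, W x -> f x != 0) -> elementaryC W f ->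
  elementaryC W (fun x => (f x)^-1).
Proof.
move=> f0 [f1 f2].
have n0 x : W x -> complex.Re (f x) * complex.Re (f x)
    + complex.Im (f x) * complex.Im (f x) != 0.
  by move=> Wx; rewrite sqr_Re_Im_eq0 f0.
have eV := elementaryV n0 (elementaryD (elementaryM f1 f1) (elementaryM f2 f2)).
split.
  apply: elementary_ext (elementaryM f1 eV) => x Wx.
  by case: (f x) => a b; rewrite -!expr2.
apply: elementary_ext (elementaryN (elementaryM f2 eV)) => x Wx.
by case: (f x) => a b /=; rewrite -!expr2.
Qed.

Lemma elementaryCS W W' f : W' `<=` W -> elementaryC W f -> elementaryC W' f.
Proof. by move=> WW' [f1 f2]; split; exact: elementaryS WW' _. Qed.

Lemma elementaryC_open_neq0 W f : open W -> elementaryC W f ->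
  open (W `&` [set x | f x != 0]).
Proof.
move=> oW [f1 f2].
rewrite (_ : [set x | f x != 0] = [set x | complex.Re (f x) * complex.Re (f x)
    + complex.Im (f x) * complex.Im (f x) != 0]).
  apply: elementary_open_neq0 => //.
  by apply: elementaryD; exact: elementaryM.
by apply/seteqP; split => x /=; rewrite sqr_Re_Im_eq0.
Qed.

(** The neighbourhood may shrink to [W'] because the target chart (an affine chart, an angular box)
    is selected by the value at [u] and remains valid only nearby. *)
Definition smooth_rep (N : atlas R) W u (F : 'rV[R]_m -> N) :=
  exists (j : idx N) (W' : set 'rV[R]_m) (g : 'rV[R]_m -> 'rV[R]_(mdim N)),
    [/\ open W', W' u, W' `<=` W, elementary_row W' g &
        forall w, W' w -> dom j (g w) /\ par j (g w) = F w].

Lemma smooth_rep_prod (M N : atlas R) W u (F : 'rV[R]_m -> M) (G : 'rV[R]_m -> N) :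
  smooth_rep W u F -> smooth_rep W u G ->
  @smooth_rep (prod_atlas M N) W u (fun w => (F w, G w)).
Proof.
move=> [i [U [f [oU Uu UW ef Ff]]]] [j [V [g [oV Vu VW eg Gg]]]].
exists (i, j), (U `&` V), (fun w => row_mx (f w) (g w)); split => /=.
- exact: openI.
- by [].
- by move=> x [/UW].
- move=> k; case: (splitP k) => k' kk'.
    have -> : k = lshift _ k' by exact: val_inj.
    apply: elementary_ext (elementaryS (@subIsetl _ U V) (ef k')) => x _.
    by rewrite row_mxEl.
  have -> : k = rshift _ k' by exact: val_inj.
  apply: elementary_ext (elementaryS (@subIsetr _ U V) (eg k')) => x _.
  by rewrite row_mxEr.
- move=> w [Uw Vw]; rewrite row_mxKl row_mxKr.
  by have [? ->] := Ff w Uw; have [? ->] := Gg w Vw.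
Qed.

Lemma smooth_rep_euclid n W u (g : 'rV[R]_m -> 'rV[R]_n) : open W -> W u ->
  elementary_row W g -> @smooth_rep (euclid R n) W u g.
Proof. by move=> oW Wu eg; exists tt, W, g; split. Qed.

Lemma smooth_rep_Rpi n W u (g : 'rV[R]_m -> 'rV[R]_n) : open W -> W u ->
  elementary_row W g ->
  @smooth_rep (Rpi_power R n) W u (fun w => \row_j modpi (g w 0 j)).
Proof.
move=> oW Wu eg.
exists (g u), (W `&` [set w | forall j, `|g w 0 j - g u 0 j| < pi / 2]), g.
split => //.
- exact: elementary_open_box.
- by split => // j; rewrite subrr normr0 divr_gt0 ?pi_gt0.
- by move=> j; apply: elementaryS (eg j).
- by move=> w [].
Qed.

(** A homogeneous coordinate that is nonzero at [u] stays nonzero nearby; dividing by it gives the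
    expression in an affine chart. *)
Lemma smooth_rep_RP n W u (g : 'rV[R]_m -> 'rV[R]_n.+1) : open W -> W u ->
  elementary_row W g -> g u != 0 ->
  @smooth_rep (RP R n) W u (fun w => hpoint (g w)).
Proof.
move=> oW Wu eg /row_neq0[i gi].
exists i, (W `&` [set w | g w 0 i != 0]),
  (fun w => \row_k (g w 0 (lift i k) / g w 0 i)); split => //.
- exact: elementary_open_neq0.
- move=> k /=; apply: (@elementary_ext _ _ _
    (fun w => g w 0 (lift i k) * (g w 0 i)^-1)); first by move=> x _; rewrite mxE.
  apply: elementaryM; first exact: elementaryS (eg _).
  by apply: elementaryV; [move=> x []|exact: elementaryS (eg _)].
- by move=> w [Ww gw]; split=> //=; rewrite (hpoint_affine gw).
Qed.

Lemma smooth_rep_CP n W u (g : 'rV[R]_m -> 'rV[R[i]]_n.+1) : open W -> W u ->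
  (forall j, elementaryC W (fun x => g x 0 j)) -> g u != 0 ->
  @smooth_rep (CP R n) W u (fun w => hpoint (g w)).
Proof.
move=> oW Wu eg /row_neq0[i gi].
pose W' := W `&` [set w | g w 0 i != 0].
have sW : W' `<=` W by exact: subIsetl.
have eq k : elementaryC W' (fun w => g w 0 (lift i k) / g w 0 i).
  apply: elementaryCM; first exact: elementaryCS sW (eg _).
  by apply: elementaryCV; [move=> x []|exact: elementaryCS sW (eg _)].
exists i, W', (fun w => row_mx
  (\row_k complex.Re (g w 0 (lift i k) / g w 0 i))
  (\row_k complex.Im (g w 0 (lift i k) / g w 0 i))); split => //.
- exact: elementaryC_open_neq0.
- move=> k /=; case: (splitP k) => k' kk'.
    have -> : k = lshift _ k' by exact: val_inj.
    by apply: elementary_ext (eq k').1 => x _; rewrite row_mxEl mxE.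
  have -> : k = rshift _ k' by exact: val_inj.
  by apply: elementary_ext (eq k').2 => x _; rewrite row_mxEr mxE.
- move=> w [Ww gw]; split=> //=; rewrite (hpoint_affine gw).
  congr affine; apply/rowP => k; rewrite row_mxKl row_mxKr !mxE.
  by case: (_ / _).
Qed.

End SmoothRepresentations.

(** Agreement of [F] with [f] is required at points of [A] only; elsewhere [F] supplies the
    extension that [smooth_on] asks for. *)
Lemma smooth_onI (R : realType) (M N : atlas R) (A : set M) (f : M -> N) :
  (forall x, A x -> exists (i : idx M) (u : 'rV[R]_(mdim M)) W
      (F : 'rV[R]_(mdim M) -> N),
    [/\ par i u = x, W `<=` dom i, smooth_rep W u F &
        forall w, W w -> A (par i w) -> f (par i w) = F w]) ->
  smooth_on A f.
Proof.
move=> H x /H[i [u [W [F [ux Wd [j [V [g [oV Vu VW eg Fg]]]] FE]]]]].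
exists i, u, j, V, g; split => //.
- by split => // w /VW/Wd.
- exact: elementary_Cinfty.
- move=> w Vw Aw; have [? ->] := Fg w Vw.
  by rewrite FE//; exact: VW.
Qed.

(* Local left inverses of [f] make it injective, so they glue to an inverse. *)
Lemma diffeoI (R : realType) (M N : atlas R) (A : set M) (B : set N)
    (f : M -> N) (x0 : M) :
  (forall x, A x -> B (f x)) ->
  (forall y, B y -> exists2 x, A x & f x = y) ->
  smooth_on A f ->
  (forall y, B y -> exists (i : idx N) (u : 'rV[R]_(mdim N)) W
      (G : 'rV[R]_(mdim N) -> M),
    [/\ par i u = y, W `<=` dom i, smooth_rep W u G &
        forall w x, W w -> A x -> f x = par i w -> G w = x]) ->
  diffeo A B f.
Proof.
move=> AB fs sf H.
(* [x0] only fills in the values of the inverse outside [B]. *)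
have /choice[g gP] : forall y, exists x, B y -> A x /\ f x = y.
  move=> y; have [/fs[x Ax fx]|nBy] := pselect (B y); first by exists x.
  by exists x0.
have finj x x' : A x -> A x' -> f x = f x' -> x = x'.
  move=> Ax Ax' xx'; have [i [u [W [G [uy _ [j [V [h [_ Vu VW _ _]]]] GP]]]]] :=
    H _ (AB _ Ax).
  have Wu := VW _ Vu.
  by rewrite -(GP u x Wu Ax (esym uy)) (GP u x' Wu Ax')// uy.
have gf x : A x -> g (f x) = x.
  by move=> Ax; have [Ag fg] := gP _ (AB _ Ax); exact: finj.
exists g; split => //.
- by move=> x Ax; split; [exact: AB|exact: gf].
apply: smooth_onI => y By; have [i [u [W [G [uy Wd Gr GP]]]]] := H y By.
exists i, u, W, G; split => // w Ww Bw; have [Ag fg] := gP _ Bw.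
by rewrite (GP w _ Ww Ag fg).
Qed.

(** * Angles modulo pi and the side vector of a triangle *)

Section Angles.
Context {R : realType}.
Implicit Types (x y p q alpha beta : R).

(** A shift by pi negates both cosine and sine, so the common sign is a power of -1. The form
    [e * e = 1] lets it be cancelled or absorbed into a scalar later. *)
Lemma trig_eqmodpi x y : modpi x = modpi y ->
  exists e : R, [/\ e * e = 1, cos x = e * cos y & sin x = e * sin y].
Proof.
move=> /eqP/modpiP[k xy]; exists ((-1) ^+ `|k|%N).
have e1 : ((-1) ^+ `|k|%N : R) * (-1) ^+ `|k|%N = 1.
  by rewrite -expr2 sqrr_sign.
(* [pi *+ n] takes a natural number, so a negative [k] is handled by exchanging [x] and [y]. *)
have [xk|xk] : x = y + pi *+ `|k|%N \/ y = x + pi *+ `|k|%N.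
  case: k xy {e1} => k xy; [left|right].
    by rewrite absz_nat -mulr_natl -[x](subrK y) xy addrC.
  by rewrite /= -[y](subKr x) xy NegzE mulrNz mulNr opprK -mulr_natl.
- by rewrite xk (alternatingn (@cosDpi R)) (alternatingn (@sinDpi R)).
- rewrite xk (alternatingn (@cosDpi R)) (alternatingn (@sinDpi R)).
  by rewrite !mulrA e1 !mul1r.
Qed.

(** Removing floor(x / pi) multiples of pi leaves a remainder in [0, pi), where the sine vanishes
    only at 0. *)
Lemma sin_eq0_modpi x : sin x = 0 -> modpi x = 0.
Proof.
move=> sx; pose k := Num.floor (x / pi); pose y := x - k%:~R * pi.
have xy : modpi x = modpi y.
  by apply/eqP/modpiP; exists k; rewrite /y opprB addrC subrK.
have [e [e1 _ sxy]] := trig_eqmodpi xy.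
have sy : sin y = 0.
  apply/eqP; move/eqP: sx; rewrite sxy mulf_eq0 => /orP[/eqP e0|//].
  by move: e1; rewrite e0 mul0r => /esym/eqP; rewrite oner_eq0.
have y0 : 0 <= y by rewrite subr_ge0 -ler_pdivlMr ?pi_gt0// ge_floor.
have ypi : y < pi.
  rewrite ltrBlDr -{1}[pi]mul1r -mulrDl -ltr_pdivrMr ?pi_gt0// addrC.
  by rewrite -[1]/(1%:~R) -intrD floorD1_gt.
rewrite xy; move: y0; rewrite le_eqVlt => /orP[/eqP <-//|y0].
by have := @sin_gt0_pi R y; rewrite y0 ypi sy ltxx => /(_ isT).
Qed.

Lemma eqmodpi_sin x y : sin (x - y) = 0 -> modpi x = modpi y.
Proof.
by move=> /sin_eq0_modpi; rewrite modpiD modpiN => /eqP; rewrite subr_eq0 => /eqP.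
Qed.

Lemma cos_atan_neq0 x : cos (atan x) != 0.
Proof. by rewrite lt0r_neq0// cos_gt0_pihalf// atan_gtNpi2 atan_ltpi2. Qed.

Lemma sin_atanE x : sin (atan x) = x * cos (atan x).
Proof. by rewrite -{2}(atanK x) /tan divfK// cos_atan_neq0. Qed.

Lemma modpi_atan x : cos x != 0 -> modpi (atan (sin x / cos x)) = modpi x.
Proof.
move=> cx; apply: eqmodpi_sin.
by rewrite sinB sin_atanE mulrAC divfK// mulrC subrr.
Qed.

Lemma atan_modpi x y : cos y != 0 -> modpi (atan x) = modpi y -> x = sin y / cos y.
Proof.
move=> cy /trig_eqmodpi[e [_ ce se]]; rewrite -[LHS]atanK /tan ce se.
have := cos_atan_neq0 x; rewrite ce mulf_eq0 negb_or => /andP[e0 _].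
by rewrite -mulf_div divff// mul1r.
Qed.

Definition cis x : R[i] := cos x +i* sin x.

Lemma cis0 : cis 0 = 1.
Proof. by rewrite /cis cos0 sin0. Qed.

Lemma cisD x y : cis (x + y) = cis x * cis y.
Proof. by rewrite /cis cosD sinD; simpc; congr (_ +i* _); ring. Qed.

Lemma cisNK x : cis (- x) * cis x = 1.
Proof. by rewrite -cisD addNr cis0. Qed.

Lemma cis_neq0 x : cis x != 0.
Proof. by apply/eqP => c0; have /eqP := cisNK x; rewrite c0 mulr0 eq_sym oner_eq0. Qed.

Lemma row3P (K : Type) (v : 'rV[K]_3) : v = row3 (v 0 0) (v 0 1) (v 0 2).
Proof.
apply/rowP => j; rewrite mxE.
by case: j => [[|[|[|//]]] jlt] /=; congr (v 0 _); exact: val_inj.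
Qed.

Lemma row3E (K : Type) (x y z : K) :
  (row3 x y z 0 0 = x) * (row3 x y z 0 1 = y) * (row3 x y z 0 2 = z).
Proof. by rewrite !mxE. Qed.

Definition angle_point alpha beta : Rpi_power R 3 :=
  \row_j modpi (row3 alpha beta (- (alpha + beta)) 0 j).

Lemma angle_pointE alpha beta : angle_point alpha beta =
  row3 (modpi alpha) (modpi beta) (- (modpi alpha + modpi beta)).
Proof.
by rewrite [LHS]row3P; congr row3; rewrite !mxE /= ?modpiN ?modpiD.
Qed.

Lemma TT_angle_point alpha beta : TT R (angle_point alpha beta).
Proof. by rewrite /TT /= angle_pointE !row3E subrr. Qed.

Lemma TT_eq (t : Rpi_power R 3) alpha beta : TT R t ->
  t 0 0 = modpi alpha -> t 0 1 = modpi beta -> t = angle_point alpha beta.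
Proof.
rewrite /TT /= => t0 ta tb; rewrite angle_pointE [LHS]row3P ta tb; congr row3.
by apply/eqP; rewrite -addr_eq0 addrC -ta -tb t0.
Qed.

(* Up to rotation and scaling, the triangle with angles alpha, beta, whose
   sides a and b have signed lengths p and q; it closes up when
   p sin beta = q sin alpha. *)
Definition side_vector p q alpha beta : 'rV[R[i]]_3 :=
  row3 (p%:C * cis (- beta)) (q%:C * cis alpha)
       (- (p * cos beta + q * cos alpha))%:C.

Lemma side_vectorZ k p q alpha beta :
  side_vector (k * p) (k * q) alpha beta = k%:C *: side_vector p q alpha beta.
Proof.
rewrite [LHS]row3P [RHS]row3P; congr row3; rewrite !mxE /= ?rmorphM ?mulrA//.
by rewrite -rmorphM/= mulrN mulrDr !mulrA.
Qed.

Lemma side_vector_neq0 p q alpha beta : (p != 0) || (q != 0) ->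
  side_vector p q alpha beta != 0.
Proof.
move=> pq; apply/eqP => /rowP v0; have := v0 0; have := v0 1.
rewrite !mxE /= => /eqP; rewrite mulf_eq0 (negbTE (cis_neq0 _)) orbF.
move=> q0 /eqP; rewrite mulf_eq0 (negbTE (cis_neq0 _)) orbF => p0.
move: pq q0 p0; rewrite -!(rmorph0 (real_complex R)) !(inj_eq (@complexI R)).
by case/orP => /negbTE ->.
Qed.

Lemma row6E (K : Type) (x y z t u v : K) :
  (row6 x y z t u v 0 (inord 0) = x) * (row6 x y z t u v 0 (inord 1) = y) *
  (row6 x y z t u v 0 (inord 2) = z) * (row6 x y z t u v 0 (inord 3) = t) *
  (row6 x y z t u v 0 (inord 4) = u) * (row6 x y z t u v 0 (inord 5) = v).
Proof. by rewrite !mxE !inordK. Qed.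

(** The modulus and the sign caused by the lift merge into one signed length [s], and a vanishing
    side gets [s = 0]; degenerate triangles then need no separate treatment. *)
Lemma arg_modpi_line (z : R[i]) (xi : Rpi R) x : (z <> 0 -> arg_modpi z xi) ->
  xi = modpi x -> exists s : R, z = s%:C * cis x.
Proof.
move=> zxi xix; have [->|/eqP z0] := eqVneq z 0; first by exists 0; rewrite mul0r.
have [r [th [r0 -> xith]]] := zxi z0; rewrite xix in xith.
have [e [e1 cE sE]] := trig_eqmodpi xith.
exists (r * e); rewrite /cis; simpc; rewrite cE sE.
by congr (_ +i* _); rewrite -mulrA [e * (e * _)]mulrA e1 mul1r.
Qed.

(** A negative length reverses the direction, which adds pi to the argument and is invisible modulo
    pi. *)
Lemma arg_modpi_cis (s x : R) : s != 0 -> arg_modpi (s%:C * cis x) (modpi x).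
Proof.
rewrite neq_lt => /orP[s0|s0].
- exists (- s), (x + pi); split; first by rewrite oppr_gt0.
    by rewrite cosDpi sinDpi !mulrNN /cis; simpc.
  by apply/eqP/modpiP; exists (-1); rewrite opprD addrA subrr sub0r mulN1r.
- by exists s, x; split => //; rewrite /cis; simpc.
Qed.

End Angles.

(** * Similarity classes described by side vectors *)

Section SimilarityClasses.
Context {R : realType}.
Local Notation Re := (@complex.Re R).
Local Notation Im := (@complex.Im R).
Implicit Types (p q alpha beta : R) (a b c : R[i]).

(** [hcoord] returns an unspecified representative, hence the unknown common real factor [k]. *)
Lemma dir_hpoint a b c : (a, b, c) <> (0, 0, 0) ->
  let x := hpoint (row6 (Re a) (Im a) (Re b) (Im b) (Re c) (Im c)) in
  exists2 k : R, k != 0 &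
    [/\ dir_a x = k%:C * a, dir_b x = k%:C * b & dir_c x = k%:C * c].
Proof.
move=> abc x; pose v := row6 (Re a) (Im a) (Re b) (Im b) (Re c) (Im c).
have v0 : v != 0.
  apply/eqP => v0; apply: abc.
  have z0 (z : R[i]) : 0 = Re z -> 0 = Im z -> z = 0 by case: z => ? ? /= <- <-.
  have := row6E (Re a) (Im a) (Re b) (Im b) (Re c) (Im c).
  rewrite -/v v0 !mxE => -[[[[[a1 a2] b1] b2] c1] c2].
  by rewrite (z0 a)// (z0 b)// (z0 c).
have [k k0 hk] := hpoint_eqP (hcoord_neq0 x) v0 (hcoordK x).
exists k => //; rewrite /dir_a /dir_b /dir_c hk.
split; rewrite ![(k *: v) _ _]mxE !row6E.
- by case: (a) => ? ? /=; simpc.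
- by case: (b) => ? ? /=; simpc.
- by case: (c) => ? ? /=; simpc.
Qed.

Lemma dir_neq0 (x : projspace R 5) :
  ~~ [&& dir_a x == 0, dir_b x == 0 & dir_c x == 0].
Proof.
apply: contra (hcoord_neq0 x); rewrite !eq_complex /=.
move=> /and3P[/andP[/eqP h0 /eqP h1] /andP[/eqP h2 /eqP h3]].
move=> /andP[/eqP h4 /eqP h5].
apply/eqP/rowP => j; rewrite [RHS]mxE.
have -> : j = inord j by rewrite inord_val.
by case: j => [[|[|[|[|[|[|//]]]]]] jlt].
Qed.

Lemma triangle_closed (tau : triangle_data R) : triangle tau ->
  dir_a (directions tau) + dir_b (directions tau) + dir_c (directions tau) = 0.
Proof.
case: tau => B0 [[a b] c] x [[xa xb] xc].
rewrite /triangle [sides _]/= [slopes _]/= [directions _]/= => -[abc xE x0 _].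
have [e|ne] := pselect ((a, b, c) = (0, 0, 0)).
  move: (x0 e); move: (dir_a x) (dir_b x) (dir_c x) => [? ?] [? ?] [? ?] /=.
  by move=> [e1 e2]; apply/eqP; rewrite eq_complex /= e1 e2 !eqxx.
rewrite xE//; have [k _ [-> -> ->]] := dir_hpoint ne.
by rewrite -!mulrDr abc mulr0.
Qed.

(** Turning the triangle so that its third side has slope 0 puts the other two at slopes -beta and
    alpha. The lifts of the angles are left free: chart coordinates and arctangents are both used
    for them below. *)
Lemma DD_side_vector (z : prod_atlas (CP R 2) (Rpi_power R 3)) alpha beta :
  DD R z -> z.2 0 0 = modpi alpha -> z.2 0 1 = modpi beta ->
  exists p q, [/\ (p != 0) || (q != 0), p * sin beta = q * sin alpha &
    z = (hpoint (side_vector p q alpha beta), angle_point alpha beta)].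
Proof.
move=> [tau tauT <-] /=; have := triangle_closed tauT.
case: tau tauT => B0 [[a b] c] x [[xa xb] xc] [/= _ _ _ [ha hb hc]] xcl.
rewrite /angles /= !row3E => al be.
pose th := repr xc; have xcE : xc = modpi th by rewrite modpi_repr.
have xbE : xb = modpi (th + alpha) by rewrite modpiD -xcE -al addrC subrK.
have xaE : xa = modpi (th - beta) by rewrite modpiD modpiN -xcE -be opprB addrC subrK.
have [p ap] := arg_modpi_line ha xaE.
have [q bq] := arg_modpi_line hb xbE.
have [r cr] := arg_modpi_line hc xcE.
(* Imaginary and real parts of the closing relation, once [cis th] has been cancelled. *)
have [e1 e2] : q * sin alpha - p * sin beta = 0 /\ p * cos beta + q * cos alpha + r = 0.
  move: xcl; rewrite ap bq cr !cisD [X in X + _ + _]mulrCA [X in _ + X + _]mulrCA.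
  rewrite [X in _ + _ + X]mulrC -!mulrDr => /eqP.
  rewrite mulf_eq0 (negbTE (cis_neq0 _)) /= => /eqP.
  rewrite /cis cosN sinN; simpc => -[h1 h2].
  by split; [rewrite -h2|rewrite -h1]; ring.
exists p, q; split.
(* If p = q = 0, the real part forces r = 0, and all three directions would vanish. *)
- have := dir_neq0 x; apply: contraNT; rewrite negb_or !negbK => /andP[/eqP p0 /eqP q0].
  move: e2; rewrite ap bq cr p0 q0 !mul0r !add0r => ->.
  by rewrite mul0r eqxx.
- by apply/esym/eqP; rewrite -subr_eq0 e1.
- congr pair.
  (* The rotation by [th] is a complex scalar, so the point of P^2(C) does not see it. *)
  rewrite -[RHS](@hpointZ _ _ (cis th)) ?cis_neq0//; congr hpoint.
  rewrite [LHS]row3P [RHS]row3P; congr row3; rewrite [RHS]mxE !row3E.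
  + by rewrite ap cisD mulrCA.
  + by rewrite bq cisD mulrCA.
  + rewrite cr mulrC; congr (_ * _%:C); apply/eqP.
    by rewrite -addr_eq0 addrC e2.
  rewrite angle_pointE -al -be; congr row3.
  by rewrite addrA subrK opprB.
Qed.

Lemma side_vector_DD p q alpha beta : (p != 0) || (q != 0) ->
  p * sin beta = q * sin alpha ->
  DD R (hpoint (side_vector p q alpha beta), angle_point alpha beta).
Proof.
move=> pq pqs; set v := side_vector _ _ _ _.
have v0 : (v 0 0, v 0 1, v 0 2) <> (0, 0, 0).
  move=> [v0 v1 v2]; have := side_vector_neq0 alpha beta pq.
  by rewrite -/v (row3P v) v0 v1 v2 => /eqP; apply; apply/rowP => j;
    rewrite !mxE; case: j => [[|[|[|//]]]].
pose x := hpoint (row6 (Re (v 0 0)) (Im (v 0 0)) (Re (v 0 1)) (Im (v 0 1))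
  (Re (v 0 2)) (Im (v 0 2))).
have [k k0 [xa xb xc]] := dir_hpoint v0; rewrite -/x in xa xb xc.
have vs : v 0 0 + v 0 1 + v 0 2 = 0.
  rewrite !row3E /cis cosN sinN; simpc; apply/eqP; rewrite eq_complex /=.
  apply/andP; split; apply/eqP; first by ring.
  by move/eqP: pqs; rewrite -subr_eq0 -oppr_eq0 => /eqP <-; ring.
(* A triangle shrunk to a point: with zero sides, its directions may be any nonzero vector that
   closes up, here the side vector. *)
exists (TriangleData 0 (0, 0, 0) x (modpi (- beta), modpi alpha, modpi 0)).
  rewrite /triangle [sides _]/= [slopes _]/= [directions _]/=; split => //.
  - by rewrite /XX /= !addr0.
  - move=> _; have : dir_a x + dir_b x + dir_c x = 0.
      by rewrite xa xb xc -!mulrDr vs mulr0.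
    by move: (dir_a x) (dir_b x) (dir_c x) => [? ?] [? ?] [? ?] [].
  - rewrite xa xb xc !row3E.
    have H s y : k%:C * (s%:C * cis y) <> 0 ->
        arg_modpi (k%:C * (s%:C * cis y)) (modpi y).
      move=> ks; rewrite mulrA -rmorphM; apply: arg_modpi_cis.
      by apply/eqP => ks0; apply: ks; rewrite mulrA -rmorphM /= ks0 mul0r.
    split; [exact: H|exact: H|].
    by have := H (- (p * cos beta + q * cos alpha)) 0; rewrite cis0 mulr1.
rewrite /similarity_class [directions _]/=; congr pair.
  rewrite xa xb xc -[RHS](@hpointZ _ _ k%:C v).
    by congr hpoint; rewrite [RHS]row3P; congr row3; rewrite [RHS]mxE.
  by rewrite -(rmorph0 (real_complex R)) (inj_eq (@complexI R)).
rewrite /angles /= angle_pointE; congr row3.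
- by rewrite modpi0 subr0.
- by rewrite modpi0 modpiN sub0r opprK.
- by rewrite modpiN opprD addrC.
Qed.

End SimilarityClasses.

(** * Elementary formulas in the coordinates of the ambient charts *)

Section ChartCoordinates.
Context {R : realType}.

Lemma elementary_lsubmx m n (W : set 'rV[R]_(m + n)) j :
  elementary W (fun w => lsubmx w 0 j).
Proof. by apply: elementary_ext (elementary_coord W (lshift n j)) => x _; rewrite mxE. Qed.

Lemma elementary_rsubmx m n (W : set 'rV[R]_(m + n)) j :
  elementary W (fun w => rsubmx w 0 j).
Proof. by apply: elementary_ext (elementary_coord W (rshift m j)) => x _; rewrite mxE. Qed.

Lemma elementary_affine_coord m n W (g : 'rV[R]_m -> 'rV[R]_n) i j :
  elementary_row W g -> elementary W (fun w => affine_coord i (g w) 0 j).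
Proof.
move=> eg; case: (unliftP i j) => [k jk|ji].
  by apply: elementary_ext (eg k) => x _; rewrite mxE jk liftK.
by apply: elementary_ext (elementary_cst W 1) => x _; rewrite mxE ji unlift_none.
Qed.

Lemma elementaryC_affine_coord m n W (g : 'rV[R]_m -> 'rV[R[i]]_n) i j :
  (forall k, elementaryC W (fun w => g w 0 k)) ->
  elementaryC W (fun w => affine_coord i (g w) 0 j).
Proof.
move=> eg; case: (unliftP i j) => [k jk|ji].
  have [e1 e2] := eg k; split; [apply: elementary_ext e1|apply: elementary_ext e2];
    by move=> x _; rewrite mxE jk liftK.
have [e1 e2] := @elementaryC_cst R m W 1.
by split; [apply: elementary_ext e1|apply: elementary_ext e2];
  move=> x _; rewrite mxE ji unlift_none.
Qed.

Definition complex_row n (w : 'rV[R]_(n + n)) : 'rV[R[i]]_n :=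
  \row_k (lsubmx w 0 k +i* rsubmx w 0 k).

Lemma CP_par_surj n (P : CP R n) : exists (i : idx (CP R n)) u, par i u = P.
Proof.
have [i [u uP]] := affine_surj P; exists i.
exists (row_mx (map_mx (@complex.Re R) u) (map_mx (@complex.Im R) u)).
rewrite -uP /=; congr affine; apply/rowP => k.
by rewrite mxE row_mxKl row_mxKr !mxE; case: (u 0 k).
Qed.

Lemma Rpi_power_par n (t : Rpi_power R n) (c := \row_j repr (t 0 j) : 'rV[R]_n) :
  (\row_j modpi (c 0 j) = t) * (forall j, `|c 0 j - c 0 j| < pi / 2).
Proof.
split; first by apply/rowP => j; rewrite !mxE modpi_repr.
by move=> j; rewrite subrr normr0 divr_gt0 ?pi_gt0.
Qed.

(** The domain of the chart of (R/pi)^n centred at [c]; the factor [setT] gives it the shape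
    produced by [elementary_open_box]. *)
Definition Rpi_box n (c : 'rV[R]_n) : set 'rV[R]_n :=
  setT `&` [set u | forall j, `|u 0 j - c 0 j| < pi / 2].

Lemma open_Rpi_box n (c : 'rV[R]_n) : open (Rpi_box c).
Proof.
apply: (@elementary_open_box _ _ _ setT (fun j u => u 0 j)); first exact: openT.
by move=> j; exact: elementary_coord.
Qed.

Definition class_box (c : 'rV[R]_3) : set 'rV[R]_(2 + 2 + 3) :=
  setT `&` [set w | forall j, `|rsubmx w 0 j - c 0 j| < pi / 2].

Lemma open_class_box c : open (class_box c).
Proof.
apply: (@elementary_open_box _ _ _ setT (fun j w => rsubmx w 0 j)); first exact: openT.
by move=> j; exact: elementary_rsubmx.
Qed.

Lemma class_chart (z : prod_atlas (CP R 2) (Rpi_power R 3)) :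
  exists (i : 'I_3) (c : 'rV[R]_3) (u : 'rV[R]_(2 + 2 + 3)),
    class_box c u /\ (hpoint (affine_coord i (complex_row (lsubmx u))),
                      \row_j modpi (rsubmx u 0 j)) = z.
Proof.
case: z => P t; have [i [u uP]] := CP_par_surj P.
pose c : 'rV[R]_3 := \row_j repr (t 0 j).
have [ct cb] : (\row_j modpi (c 0 j) = t) * (forall j, `|c 0 j - c 0 j| < pi / 2).
  exact: Rpi_power_par.
by exists i, c, (row_mx u c); rewrite /class_box /= row_mxKl row_mxKr ct -uP.
Qed.

Definition row2 (K : Type) (x y : K) : 'rV[K]_2 := \row_j nth x [:: x; y] j.

Lemma row2E (K : Type) (x y : K) : (row2 x y 0 0 = x) * (row2 x y 0 1 = y).
Proof. by rewrite !mxE. Qed.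

Lemma row2P (K : Type) (v : 'rV[K]_2) : v = row2 (v 0 0) (v 0 1).
Proof.
apply/rowP => j; rewrite mxE.
by case: j => [[|[|//]] jlt] /=; congr (v 0 _); exact: val_inj.
Qed.

Lemma row2_neq0 (h : 'rV[R]_2) : (h != 0) = (h 0 0 != 0) || (h 0 1 != 0).
Proof.
rewrite -negb_and; congr negb; apply/eqP/andP => [->|[/eqP h0 /eqP h1]].
  by rewrite !mxE eqxx.
by rewrite (row2P h) h0 h1; apply/rowP => j; rewrite !mxE; case: j => [[|[|//]]].
Qed.

Lemma elementary_row2 m (W : set 'rV[R]_m) f g :
  elementary W f -> elementary W g ->
  elementary_row W (fun w => row2 (f w) (g w)).
Proof.
move=> ef eg [[|[|//]] jlt]; [apply: elementary_ext ef|apply: elementary_ext eg];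
  by move=> x _; rewrite mxE.
Qed.

Lemma elementary_row3 m (W : set 'rV[R]_m) f g h :
  elementary W f -> elementary W g -> elementary W h ->
  elementary_row W (fun w => row3 (f w) (g w) (h w)).
Proof.
move=> ef eg eh [[|[|[|//]]] jlt];
  [apply: elementary_ext ef|apply: elementary_ext eg|apply: elementary_ext eh];
  by move=> x _; rewrite mxE.
Qed.

Lemma elementaryC_cis m (W : set 'rV[R]_m) f : elementary W f ->
  elementaryC W (fun w => cis (f w)).
Proof. by move=> ef; split; [exact: elementary_cos|exact: elementary_sin]. Qed.

Lemma elementaryC_real m (W : set 'rV[R]_m) f : elementary W f ->
  elementaryC W (fun w => (f w)%:C).
Proof. by move=> ef; split => //=; exact: elementary_cst. Qed.

Lemma elementaryC_side_vector m (W : set 'rV[R]_m) p q a b j :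
  elementary W p -> elementary W q -> elementary W a -> elementary W b ->
  elementaryC W (fun w => side_vector (p w) (q w) (a w) (b w) 0 j).
Proof.
move=> ep eq ea eb.
have e0 : elementaryC W (fun w => (p w)%:C * cis (- b w)).
  apply: elementaryCM; first exact: elementaryC_real.
  by apply: elementaryC_cis; exact: elementaryN.
have e1 : elementaryC W (fun w => (q w)%:C * cis (a w)).
  by apply: elementaryCM; [exact: elementaryC_real|exact: elementaryC_cis].
have e2 : elementaryC W (fun w => (- (p w * cos (b w) + q w * cos (a w)))%:C).
  apply: elementaryC_real; apply: elementaryN.
  by apply: elementaryD; apply: elementaryM => //; exact: elementary_cos.
case: j => [[|[|[|//]]] jlt];
  [case: e0 => e e'|case: e1 => e e'|case: e2 => e e'];
  split; [apply: elementary_ext e|apply: elementary_ext e'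
    |apply: elementary_ext e|apply: elementary_ext e'
    |apply: elementary_ext e|apply: elementary_ext e'];
  by move=> x _; rewrite mxE.
Qed.

Lemma smooth_rep_angle_point m (W : set 'rV[R]_m) u a b : open W -> W u ->
  elementary W a -> elementary W b ->
  smooth_rep W u (fun w => angle_point (a w) (b w)).
Proof.
move=> oW Wu ea eb; apply: smooth_rep_Rpi => //.
by apply: elementary_row3 => //; apply: elementaryN; exact: elementaryD.
Qed.

End ChartCoordinates.

(** * The projection away from 0, the tangent chart and the blowup chart *)

Section Blowup.
Context {R : realType}.
Local Notation classes := (prod_atlas (CP R 2) (Rpi_power R 3)).
Implicit Types (p q alpha beta : R).

Lemma DD_TT (z : classes) : DD R z -> TT R z.2.
Proof.
move=> Dz; have [p [q [_ _ ->]]] := DD_side_vector Dz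
  (esym (modpi_repr _)) (esym (modpi_repr _)).
exact: TT_angle_point.
Qed.

Lemma smooth_pi_TT (A : set classes) : smooth_on A (pi_TT R).
Proof.
apply: smooth_onI => z _; have [i [c [u [cu uz]]]] := class_chart z.
exists (i, c), u, (class_box c), (fun w => \row_j modpi (rsubmx w 0 j)).
split => //; apply: (@smooth_rep_Rpi _ _ _ _ _ (fun w => rsubmx w)) => //.
- exact: open_class_box.
- by move=> j; exact: elementary_rsubmx.
Qed.

(** Both the law of sines and the incidence relation of the plane blowup are vanishing 2 by 2
    determinants; this converts them into proportionality. *)
Lemma proportional p q (a b : R) : (p != 0) || (q != 0) -> (a != 0) || (b != 0) ->
  p * b = q * a -> exists2 k, k != 0 & p = k * a /\ q = k * b.
Proof.
move=> pq ab e; have [a0|a0] := eqVneq a 0.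
  have b0 : b != 0 by move: ab; rewrite a0 eqxx.
  have p0 : p = 0.
    by apply/eqP; move/eqP: e; rewrite a0 mulr0 mulf_eq0 (negbTE b0) orbF.
  move: pq; rewrite p0 eqxx /= => q0.
  by exists (q / b); rewrite ?a0 ?mulr0 ?divfK// mulf_neq0 ?invr_neq0.
exists (p / a); last by rewrite divfK// mulrAC e mulfK.
rewrite mulf_neq0 ?invr_neq0//; apply: contraTneq pq => p0.
by rewrite p0 eqxx /=; move/esym/eqP: e; rewrite p0 mul0r mulf_eq0 (negbTE a0) orbF => ->.
Qed.

Lemma angle_point_neq0 alpha beta : angle_point alpha beta <> 0 ->
  (sin alpha != 0) || (sin beta != 0).
Proof.
move=> ab; rewrite -negb_and; apply/negP => /andP[/eqP sa /eqP sb]; apply: ab.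
rewrite angle_pointE (sin_eq0_modpi sa) (sin_eq0_modpi sb) addr0 oppr0.
by apply/rowP => j; rewrite !mxE; case: j => [[|[|[|//]]]].
Qed.

Lemma diffeo_pi_TT :
  diffeo (DD R `\` pi_TT R @^-1` [set (0 : 'rV[Rpi R]_3)])
         (TT R `\ (0 : 'rV[Rpi R]_3)) (pi_TT R).
Proof.
apply: (@diffeoI _ classes (Rpi_power R 3) _ _ _ (hpoint 0, 0 : 'rV[Rpi R]_3)).
- by move=> z [Dz z0]; split => //; exact: DD_TT.
- move=> t [Tt t0].
  have tE := TT_eq Tt (esym (modpi_repr _)) (esym (modpi_repr _)).
  move: tE; set al := repr _; set be := repr _ => tE.
  exists (hpoint (side_vector (sin al) (sin be) al be), t) => //.
  split => //; rewrite tE; apply: side_vector_DD; last exact: mulrC.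
  by apply: angle_point_neq0; rewrite -tE.
- exact: smooth_pi_TT.
- move=> t [Tt t0]; pose c : 'rV[R]_3 := \row_j repr (t 0 j).
  have [ct cb] : (\row_j modpi (c 0 j) = t) * (forall j, `|c 0 j - c 0 j| < pi / 2).
    exact: Rpi_power_par.
  (* The chart coordinates [w] are themselves lifts of the angles, so the law of sines evaluated at
     them is an elementary formula, free of chosen representatives. *)
  exists c, c, (Rpi_box c), (fun w => (hpoint (side_vector (sin (w 0 0))
    (sin (w 0 1)) (w 0 0) (w 0 1)), angle_point (w 0 0) (w 0 1))).
  have bc : Rpi_box c c by [].
  have tE : t = angle_point (c 0 0) (c 0 1).
    by apply: TT_eq => //; rewrite -ct !mxE.
  split => //; first by move=> w [].
    apply: smooth_rep_prod; last first.
      by apply: smooth_rep_angle_point;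
        [exact: open_Rpi_box|by []|exact: elementary_coord|exact: elementary_coord].
    apply: smooth_rep_CP => //; first exact: open_Rpi_box.
      by move=> j; apply: elementaryC_side_vector;
        [apply: elementary_sin|apply: elementary_sin| |]; exact: elementary_coord.
    by apply: side_vector_neq0; apply: angle_point_neq0; rewrite -tE.
  move=> w z _ [Dz z0] /= zw.
  have [||p [q [pq pqs zE]]] := @DD_side_vector _ z (w 0 0) (w 0 1) Dz.
  + by rewrite -[z.2]/(pi_TT R z) zw mxE.
  + by rewrite -[z.2]/(pi_TT R z) zw mxE.
  have s0 : (sin (w 0 0) != 0) || (sin (w 0 1) != 0).
    by apply: angle_point_neq0; move: z0; rewrite zE.
  have [k k0 [pk qk]] := proportional pq s0 pqs.
  rewrite zE pk qk side_vectorZ hpointZ//.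
  by rewrite -(rmorph0 (real_complex R)) (inj_eq (@complexI R)).
Qed.

(** The region where tan alpha and tan beta are finite. Using [repr] is harmless, since the
    vanishing of a cosine does not depend on the lift. *)
Definition chart_image : set (Rpi_power R 3) :=
  [set t | cos (repr (t 0 0)) * cos (repr (t 0 1)) != 0].

Lemma cos_repr_modpi (x : R) : (cos (repr (modpi x)) == 0) = (cos x == 0).
Proof.
have [e [e1 -> _]] := trig_eqmodpi (modpi_repr (modpi x)).
rewrite mulf_eq0 orbC; case: eqP => //= _; apply/eqP => e0.
by move/eqP: e1; rewrite e0 mul0r eq_sym oner_eq0.
Qed.

Lemma chart_imageE (t : Rpi_power R 3) (x y : R) :
  t 0 0 = modpi x -> t 0 1 = modpi y ->
  chart_image t = (cos x * cos y != 0).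
Proof.
by move=> tx ty; rewrite /chart_image /= tx ty !mulf_eq0 !cos_repr_modpi.
Qed.

Lemma mopen_chart_image : mopen chart_image.
Proof.
move=> c.
rewrite (_ : _ `&` _ = Rpi_box c `&` [set u | cos (u 0 0) * cos (u 0 1) != 0]).
  apply: elementary_open_neq0; first exact: open_Rpi_box.
  by apply: elementaryM; apply: elementary_cos; exact: elementary_coord.
have E (u : 'rV[R]_3) : chart_image (\row_j modpi (u 0 j)) =
    (cos (u 0 0) * cos (u 0 1) != 0) by apply: chart_imageE; rewrite mxE.
apply/seteqP; split => u /=; rewrite E; last by move=> [[_ cu] ?].
by move=> [cu ?]; split.
Qed.

Definition chart (v : euclid R 2) : Rpi_power R 3 :=
  angle_point (atan (v 0 0)) (atan (v 0 1)).

Lemma chart_image_chart v : chart_image (chart v).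
Proof.
rewrite (@chart_imageE _ (atan (v 0 0)) (atan (v 0 1))) ?mxE//.
by rewrite mulf_neq0 ?cos_atan_neq0.
Qed.

Lemma chart_inv (t : Rpi_power R 3) (v : euclid R 2) alpha beta :
  cos alpha * cos beta != 0 ->
  t 0 0 = modpi alpha -> t 0 1 = modpi beta -> chart v = t ->
  v = row2 (sin alpha / cos alpha) (sin beta / cos beta).
Proof.
rewrite mulf_eq0 negb_or => /andP[ca cb] ta tb vt.
rewrite [LHS]row2P; congr row2; apply: atan_modpi => //.
  by rewrite -ta -vt !mxE.
by rewrite -tb -vt !mxE.
Qed.

Lemma diffeo_chart :
  diffeo ([set: 'rV[R]_2] : set (euclid R 2)) (TT R `&` chart_image) chart.
Proof.
apply: (@diffeoI _ (euclid R 2) (Rpi_power R 3) _ _ _ (0 : 'rV[R]_2)).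
- by move=> v _; split; [exact: TT_angle_point|exact: chart_image_chart].
- move=> t [Tt]; rewrite /chart_image /=; set al := repr _; set be := repr _.
  rewrite mulf_eq0 negb_or => /andP[ca cb].
  exists (row2 (sin al / cos al) (sin be / cos be)) => //.
  apply/esym; apply: TT_eq => //; rewrite row2E modpi_atan//; exact/esym/modpi_repr.
- apply: smooth_onI => v _; exists tt, v, setT, chart; split => //.
  by apply: smooth_rep_angle_point => //; [exact: openT| |];
    apply: elementary_atan; exact: elementary_coord.
- move=> t [Tt Ot]; pose c : 'rV[R]_3 := \row_j repr (t 0 j).
  have [ct cb] : (\row_j modpi (c 0 j) = t) * (forall j, `|c 0 j - c 0 j| < pi / 2).
    exact: Rpi_power_par.
  pose W := Rpi_box c `&` [set u | cos (u 0 0) * cos (u 0 1) != 0].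
  have eW (j : 'I_3) : (forall w, W w -> cos (w 0 j) != 0) ->
      elementary W (fun w => sin (w 0 j) / cos (w 0 j)).
    move=> cW; apply: elementaryM; first exact/elementary_sin/elementary_coord.
    by apply: elementaryV => //; exact/elementary_cos/elementary_coord.
  exists c, c, W, (fun w => row2 (sin (w 0 0) / cos (w 0 0)) (sin (w 0 1) / cos (w 0 1))).
  split => //; first by move=> w [[]].
    apply: smooth_rep_euclid.
    + apply: elementary_open_neq0; first exact: open_Rpi_box.
      by apply: elementaryM; apply: elementary_cos; exact: elementary_coord.
    + by split => //; rewrite /= !mxE.
    + by apply: elementary_row2; apply: eW => w [_] /=;
        rewrite mulf_eq0 negb_or => /andP[].
  move=> w v [_ /= cw] _ vw; apply/esym.
  by apply: chart_inv vw => //; rewrite mxE.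
Qed.

(** Solving [h0 : h1] = [p cos beta : q cos alpha] for [p : q] gives [h0 cos alpha : h1 cos beta];
    the arctangents are the lifts. *)
Definition blowup_chart (z : plane_x_RP1 R) : classes :=
  let h := hcoord z.2 in
  let al := atan (z.1 0 0) in let be := atan (z.1 0 1) in
  (hpoint (side_vector (h 0 0 * cos al) (h 0 1 * cos be) al be), chart z.1).

(** The coordinates picked by [hcoord] may be rescaled by any nonzero real, so they can be replaced
    by ones that vary smoothly. *)
Lemma blowup_chart_hpoint (v : 'rV[R]_2) (h : 'rV[R]_2) : h != 0 ->
  blowup_chart (v, hpoint h) =
  (hpoint (side_vector (h 0 0 * cos (atan (v 0 0))) (h 0 1 * cos (atan (v 0 1)))
     (atan (v 0 0)) (atan (v 0 1))), chart v).
Proof.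
move=> h0; rewrite /blowup_chart /=.
have [k k0 ->] := hpoint_eqP (hcoord_neq0 (hpoint h)) h0 (hcoordK _).
rewrite !mxE -!mulrA side_vectorZ hpointZ//.
by rewrite -(rmorph0 (real_complex R)) (inj_eq (@complexI R)).
Qed.

Lemma plane_blowup_hpoint (v h : 'rV[R]_2) : h != 0 ->
  plane_blowup setT (v, hpoint h) <-> h 0 0 * v 0 1 = h 0 1 * v 0 0.
Proof.
move=> h0; rewrite /plane_blowup /= val_hpoint//; split.
  by move=> [_ /vlineP[k ->]]; rewrite !mxE; ring.
move=> hv; split => //; apply/vlineP.
(* The origin lies on every line: this is the exceptional fibre. *)
have [->|] := eqVneq v 0; first by exists 0; rewrite scale0r.
rewrite row2_neq0 => v0; move: (h0); rewrite row2_neq0 => h0'.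
have vh : v 0 0 * h 0 1 = v 0 1 * h 0 0 by rewrite mulrC -hv mulrC.
have [k _ [e0 e1]] := proportional v0 h0' vh.
by exists k; rewrite [LHS]row2P [RHS]row2P e0 e1 !mxE.
Qed.

(** As sin (atan x) = x cos (atan x), both sides of the closing relation carry the factor cos alpha
    cos beta, and what remains is the incidence relation. *)
Lemma blowup_chart_DD z : plane_blowup setT z -> DD R (blowup_chart z).
Proof.
case: z => v l; rewrite -{1}(hcoordK l) plane_blowup_hpoint ?hcoord_neq0// => hv.
apply: side_vector_DD => /=.
  by rewrite !mulf_eq0 !(negbTE (cos_atan_neq0 _)) !orbF -row2_neq0 hcoord_neq0.
by rewrite !sin_atanE mulrACA hv; ring.
Qed.

(** [DD_side_vector] is applied with arctangents as lifts, the ones built into [blowup_chart];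
    dividing p and q by the cosines then recovers the line. *)
Lemma blowup_chart_surj (z : classes) : DD R z -> chart_image z.2 ->
  exists2 x, plane_blowup setT x & blowup_chart x = z.
Proof.
move=> Dz; rewrite /chart_image /=; set al := repr _; set be := repr _.
rewrite mulf_eq0 negb_or => /andP[ca cb].
pose x := sin al / cos al; pose y := sin be / cos be.
have [||p [q [pq pqs zE]]] := @DD_side_vector _ z (atan x) (atan y) Dz.
- by rewrite modpi_atan// modpi_repr.
- by rewrite modpi_atan// modpi_repr.
have cx := cos_atan_neq0 x; have cy := cos_atan_neq0 y.
pose h := row2 (p / cos (atan x)) (q / cos (atan y)).
have h0 : h != 0.
  by rewrite row2_neq0 !row2E !mulf_eq0 !invr_eq0 (negbTE cx) (negbTE cy) !orbF.
exists (row2 x y, hpoint h).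
  rewrite plane_blowup_hpoint// !row2E; move: pqs; rewrite !sin_atanE => pqs.
  have -> : p / cos (atan x) * y =
      p * (y * cos (atan y)) / (cos (atan x) * cos (atan y)).
    by field; rewrite cx cy.
  by rewrite pqs; field; rewrite cx cy.
by rewrite blowup_chart_hpoint// /chart !row2E !divfK// zE.
Qed.

Lemma blowup_chart_smooth : smooth_on (plane_blowup setT) blowup_chart.
Proof.
apply: smooth_onI => -[v l] _; have [i [u ul]] := affine_surj l.
pose h (w : 'rV[R]_(2 + 1)) := affine_coord i (rsubmx w).
pose al (w : 'rV[R]_(2 + 1)) := atan (lsubmx w 0 0).
pose be (w : 'rV[R]_(2 + 1)) := atan (lsubmx w 0 1).
have eal : elementary setT al by exact/elementary_atan/elementary_lsubmx.
have ebe : elementary setT be by exact/elementary_atan/elementary_lsubmx.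
exists (tt, i), (row_mx v u), setT, (fun w : 'rV[R]_(2 + 1) =>
  (hpoint (side_vector (h w 0 0 * cos (al w)) (h w 0 1 * cos (be w)) (al w) (be w)),
   angle_point (al w) (be w))); split => //.
- by rewrite /= row_mxKl row_mxKr ul.
- apply: smooth_rep_prod; last by apply: smooth_rep_angle_point => //; exact: openT.
  apply: smooth_rep_CP => //; first exact: openT.
    have eh j : elementary setT (fun w => h w 0 j).
      by apply: elementary_affine_coord => k; exact: elementary_rsubmx.
    by move=> j; apply: elementaryC_side_vector => //; apply: elementaryM => //;
      exact: elementary_cos.
  apply: side_vector_neq0; rewrite !mulf_eq0 !(negbTE (cos_atan_neq0 _)) !orbF.
  by rewrite -row2_neq0 affine_coord_neq0.
- by move=> w _ _; rewrite [par _ _]/= blowup_chart_hpoint// affine_coord_neq0.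
Qed.

(* From homogeneous coordinates [h] of the sides and lifts of the angles, a
   complex multiple of homogeneous coordinates of the point of P^1(R). *)
Definition line_coord (h : 'rV[R[i]]_3) alpha beta : R[i] * R[i] :=
  (h 0 0 * (cis beta * (cos beta)%:C), h 0 1 * (cis (- alpha) * (cos alpha)%:C)).

(** The factors [cis beta] and [cis (- alpha)] undo the rotations of the first two sides. The signs
    comparing alpha and beta with the arctangents enter both entries equally, because e^(i beta) cos
    beta and e^(-i alpha) cos alpha have period pi, and so they go into [l]. *)
Lemma line_coordE (x : plane_x_RP1 R) (h : 'rV[R[i]]_3) alpha beta
    (t : 'rV[Rpi R]_3) :
  h != 0 -> cos alpha * cos beta != 0 ->
  t 0 0 = modpi alpha -> t 0 1 = modpi beta -> blowup_chart x = (hpoint h, t) ->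
  exists2 l : R[i], l != 0 & line_coord h alpha beta =
    (l * (hcoord x.2 0 0)%:C, l * (hcoord x.2 0 1)%:C).
Proof.
move=> h0 cab ta tb [xh xt].
have sv0 : side_vector (hcoord x.2 0 0 * cos (atan (x.1 0 0)))
  (hcoord x.2 0 1 * cos (atan (x.1 0 1))) (atan (x.1 0 0)) (atan (x.1 0 1)) != 0.
  apply: side_vector_neq0; rewrite !mulf_eq0 !(negbTE (cos_atan_neq0 _)) !orbF.
  by rewrite -row2_neq0 hcoord_neq0.
have [k k0 hk] := hpoint_eqP h0 sv0 (esym xh).
have : modpi (atan (x.1 0 0)) = modpi alpha by rewrite -ta -xt !mxE.
move=> /trig_eqmodpi[e [e1 ce se]].
have : modpi (atan (x.1 0 1)) = modpi beta by rewrite -tb -xt !mxE.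
move=> /trig_eqmodpi[e' [e1' ce' se']].
exists (k * (e * e' * (cos alpha * cos beta))%:C).
  rewrite mulf_neq0// -(rmorph0 (real_complex R)) (inj_eq (@complexI R)).
  have sq1 y : y * y = 1 -> y != 0 :> R.
    by move=> yy; apply/eqP => y0; move/eqP: yy; rewrite y0 mul0r eq_sym oner_eq0.
  by rewrite mulf_neq0// mulf_neq0// sq1.
have ca : cis (atan (x.1 0 0)) = e%:C * cis alpha by rewrite /cis ce se; simpc.
have cb : cis (- atan (x.1 0 1)) = e'%:C * cis (- beta).
  by rewrite /cis !cosN !sinN ce' se' -mulrN; simpc.
rewrite /line_coord hk; congr pair; rewrite mxE !row3E ?ca ?cb ?ce ?ce' !rmorphM /=.
- transitivity (k * (e%:C * e'%:C * ((cos alpha)%:C * (cos beta)%:C)) *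
    (hcoord x.2 0 0)%:C * (cis (- beta) * cis beta)); first by ring.
  by rewrite cisNK mulr1.
- transitivity (k * (e%:C * e'%:C * ((cos alpha)%:C * (cos beta)%:C)) *
    (hcoord x.2 0 1)%:C * (cis (- alpha) * cis alpha)); first by ring.
  by rewrite cisNK mulr1.
Qed.

(* Dividing out the complex factor by means of the reference line through
   [h0], up to a positive real factor. *)
Definition real_line (h0 : 'rV[R]_2) (c : R[i] * R[i]) : R[i] :=
  (h0 0 0)%:C * c.1 + (h0 0 1)%:C * c.2.

Definition real_coord (h0 : 'rV[R]_2) (c : R[i] * R[i]) : 'rV[R]_2 :=
  row2 (complex.Re (c.1 * (real_line h0 c)^*)) (complex.Re (c.2 * (real_line h0 c)^*)).

(** For c = l h the reference form is l <h0, h>; multiplying c by its conjugate leaves |l|^2 <h0, h>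
    h, which is already real, and the hypothesis makes this factor nonzero. *)
Lemma real_coordE (h0 h : 'rV[R]_2) (l : R[i]) (c := (l * (h 0 0)%:C, l * (h 0 1)%:C)) :
  real_line h0 c != 0 -> exists2 k, k != 0 & real_coord h0 c = k *: h.
Proof.
have sE : real_line h0 c = l * (h0 0 0 * h 0 0 + h0 0 1 * h 0 1)%:C.
  by rewrite /real_line /= rmorphD !rmorphM /=; ring.
rewrite /real_coord sE /=; set n := h0 0 0 * _ + _ => sn0.
have [l0 n0] : l != 0 /\ n != 0.
  by move: sn0; rewrite mulf_eq0 negb_or -(rmorph0 (real_complex R))
    (inj_eq (@complexI R)) => /andP[].
exists ((complex.Re l * complex.Re l + complex.Im l * complex.Im l) * n).
  by rewrite mulf_neq0// sqr_Re_Im_eq0.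
rewrite [RHS]row2P; congr row2; rewrite mxE; case: (l) => a b; simpc => /=; ring.
Qed.


End Blowup.

(** * Smoothness of the inverse of the blowup chart *)

Section BlowupChart.
Context {R : realType}.
Local Notation classes := (prod_atlas (CP R 2) (Rpi_power R 3)).

Lemma elementaryC_line_coord m (W : set 'rV[R]_m) (h : 'rV[R]_m -> 'rV[R[i]]_3)
    a b :
  (forall j, elementaryC W (fun w => h w 0 j)) ->
  elementary W a -> elementary W b ->
  elementaryC W (fun w => (line_coord (h w) (a w) (b w)).1) /\
  elementaryC W (fun w => (line_coord (h w) (a w) (b w)).2).
Proof.
move=> eh ea eb; split; apply: elementaryCM => //; apply: elementaryCM.
- exact: elementaryC_cis.
- exact/elementaryC_real/elementary_cos.
- exact/elementaryC_cis/elementaryN.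
- exact/elementaryC_real/elementary_cos.
Qed.

(** The local inverse takes the tangents of the angular coordinates and extracts the line from the
    complex ones, with the line of a preimage [x0] of the given class as reference. *)
Lemma diffeo_blowup_chart :
  diffeo (plane_blowup setT) (DD R `&` pi_TT R @^-1` chart_image) (@blowup_chart R).
Proof.
apply: (@diffeoI _ (plane_x_RP1 R) classes _ _ _ (0 : 'rV[R]_2, hpoint 0)).
- by move=> x Bx; split; [exact: blowup_chart_DD|exact: chart_image_chart].
- by move=> z [Dz Oz]; have [x] := blowup_chart_surj Dz Oz; exists x.
- exact: blowup_chart_smooth.
move=> z [Dz Oz]; have [x0 Bx0 x0z] := blowup_chart_surj Dz Oz.
have [i [c [u [cu uz]]]] := class_chart z.
pose h (w : 'rV[R]_(2 + 2 + 3)) := affine_coord i (complex_row (lsubmx w)).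
pose al (w : 'rV[R]_(2 + 2 + 3)) := rsubmx w 0 0.
pose be (w : 'rV[R]_(2 + 2 + 3)) := rsubmx w 0 1.
pose c2 w := line_coord (h w) (al w) (be w).
pose W1 := class_box c `&` [set w | cos (al w) * cos (be w) != 0].
(* The added condition keeps the sought line from being orthogonal to the reference line. *)
pose W := W1 `&` [set w | real_line (hcoord x0.2) (c2 w) != 0].
have eal V : elementary V al by exact: elementary_rsubmx.
have ebe V : elementary V be by exact: elementary_rsubmx.
have eh V j : elementaryC V (fun w => h w 0 j).
  apply: elementaryC_affine_coord => k.
  have eC : elementaryC V (fun w => lsubmx (lsubmx w) 0 k +i* rsubmx (lsubmx w) 0 k).
    split => /=.
      apply: elementary_ext (elementary_lsubmx V (lshift 2 k)) => w _.
      by rewrite !mxE.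
    apply: elementary_ext (elementary_lsubmx V (rshift 2 k)) => w _.
    by rewrite !mxE.
  by case: eC => e e'; split; [apply: elementary_ext e|apply: elementary_ext e'];
    move=> w _; rewrite [complex_row _ _ _]mxE.
have ec V := elementaryC_line_coord (eh V) (eal V) (ebe V).
have el V : elementaryC V (fun w => real_line (hcoord x0.2) (c2 w)).
  by have [e1 e2] := ec V; apply: elementaryCD; apply: elementaryCM => //;
    exact: elementaryC_cst.
have lineE w x : cos (al w) * cos (be w) != 0 ->
    blowup_chart x = (hpoint (h w), \row_j modpi (rsubmx w 0 j)) ->
    exists2 l : R[i], l != 0 &
      c2 w = (l * (hcoord x.2 0 0)%:C, l * (hcoord x.2 0 1)%:C).
  by move=> cw; apply: line_coordE; rewrite ?affine_coord_neq0// mxE.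
have cu0 : cos (al u) * cos (be u) != 0.
  by move: Oz; rewrite /= (@chart_imageE _ _ (al u) (be u))// -uz mxE.
have Wu : W u.
  split => //=; have [l l0 ->] := lineE u x0 cu0 (etrans x0z (esym uz)).
  (* At [u] the reference vector is paired with itself, which gives a nonzero sum of squares. *)
  rewrite (_ : real_line _ _ = l * (hcoord x0.2 0 0 ^+ 2 + hcoord x0.2 0 1 ^+ 2)%:C).
    rewrite mulf_neq0// -(rmorph0 (real_complex R)) (inj_eq (@complexI R)).
    by rewrite paddr_eq0 ?sqr_ge0// !sqrf_eq0 negb_and -row2_neq0 hcoord_neq0.
  by rewrite /real_line /= rmorphD !rmorphXn /=; ring.
have oW : open W.
  apply: elementaryC_open_neq0 => //; apply: elementary_open_neq0.
    exact: open_class_box.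
  by apply: elementaryM; exact: elementary_cos.
have W1c w : W w -> cos (al w) != 0 /\ cos (be w) != 0.
  by move=> [[_ /=]]; rewrite mulf_eq0 negb_or => /andP[].
exists (i, c), u, W, (fun w =>
  (row2 (sin (al w) / cos (al w)) (sin (be w) / cos (be w)) : 'rV[R]_2,
   hpoint (real_coord (hcoord x0.2) (c2 w)))).
split => //.
- by move=> w [[[_]]].
- apply: smooth_rep_prod.
    apply: smooth_rep_euclid => //.
    by apply: elementary_row2; apply: elementaryM;
      [exact: elementary_sin| |exact: elementary_sin|];
      apply: elementaryV; [by move=> w /W1c[]|exact: elementary_cos
        |by move=> w /W1c[]|exact: elementary_cos].
  apply: smooth_rep_RP => //.
    have [e1 e2] := ec W; have es := elementaryC_conj (el W).
    by apply: elementary_row2;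
      [exact: (elementaryCM e1 es).1|exact: (elementaryCM e2 es).1].
  case: Wu => _ /=; have [l l0 ->] := lineE u x0 cu0 (etrans x0z (esym uz)).
  by move=> /real_coordE[k k0 ->]; rewrite scaler_eq0 negb_or k0 hcoord_neq0.
move=> w [v l] [[_ /= cw] /= sw] _ xw.
have [k k0 kE] := lineE w (v, l) cw xw.
(* [real_coord] turns the complex factor into a real one, which [hpointZ] then discards. *)
rewrite kE in sw *; have [k' k0' ->] := real_coordE sw.
rewrite hpointZ// hcoordK; congr pair; apply/esym.
by move: xw => [_ xt]; apply: chart_inv xt => //; rewrite mxE.
Qed.

End BlowupChart.

Theorem proposition7p2p2 (R : realType) :
  is_real_blowup (DD R) (TT R) (0%R : 'rV[Rpi R]_3) (pi_TT R).
Proof.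
split.
- by rewrite /TT /= !mxE !addr0.
- exact: smooth_pi_TT.
- exact: diffeo_pi_TT.
(* Tangents take all real values, so the whole plane serves as [V]. Compatibility with the blowdown
   holds by computation, [chart] being the second component of [blowup_chart]. *)
exists setT, chart_image, (@chart R), (@blowup_chart R); split => //.
- by split => //; exact: openT.
- exact: mopen_chart_image.
- split; first exact: diffeo_chart.
  rewrite /chart !mxE atan0 angle_pointE modpi0 addr0 oppr0.
  by apply/rowP => j; rewrite !mxE; case: j => [[|[|[|//]]]].
- exact: diffeo_blowup_chart.
Qed.
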